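(* Let $\mathcal G=(\mathcal G^1,\mathcal G^0)$ be a groupoid with a cyclic structure $\theta$, and put $\mathcal B=\mathbb{C}\mathcal G^1$, $C=\mathbb{C}\mathcal G^0$. Let $C_\bullet(\mathcal G,\theta)$ be the cyclic module generated by the nerve, and let $C_n(\mathcal B,{}^\theta C)=\mathcal B^{\square_C(n+1)}\,\square_{\mathcal B}\,C$, which has as a basis the symbols $[g_0,\dots,g_n,c]$ with $g_i\in\mathcal G^1$, $c\in\mathcal G^0$, $s(g_i)=t(g_{i+1})$ for $0\le i<n$, $s(g_n)=t(g_0)$ and $g_0\cdots g_n=\theta_c$. Then $C_\bullet(\mathcal B,{}^\theta C)$ is a cyclic module via $$\partial_i[g_0,\dots,g_n,c]=[g_0,\dots,g_ig_{i+1},\dots,g_n,c]\quad(0\le i<n),$$ $$\partial_n[g_0,\dots,g_n,c]=[g_ng_0,g_1,\dots,g_{n-1},c\cdot g_n^{-1}],$$ $$\sigma_j[g_0,\dots,g_n,c]=[g_0,\dots,g_j,\mathrm{Id}_{s(g_j)},g_{j+1},\dots,g_n,c]\quad(0\le j\le n),$$ $$\tau[g_0,\dots,g_n,c]=[g_n,g_0,\dots,g_{n-1},c\cdot g_n^{-1}],$$ and the map $\mathcal I:C_\bullet(\mathcal B,{}^\theta C)\to C_\bullet(\mathcal G,\theta)$, $\mathcal I([g_0,\dots,g_n,c])=[g_1,\dots,g_n]$ (for $n=0$: $\mathcal I([g_0,c])=c$), is an isomorphism of cyclic modules, with inverse $$\mathcal I^{-1}([g_1,\dots,g_n])=[\theta_{s(g_n)}(g_1\cdots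 g_n)^{-1},g_1,\dots,g_n,s(g_n)]$$ (for $n=0$: $A\mapsto[\theta_A,A]$).
   Context: $\mathcal G^1$ is the set of morphisms and $\mathcal G^0$ the set of objects of $\mathcal G$; for $g\in\mathrm{Mor}(x,y)$, $s(g)=x$ and $t(g)=y$; $gh$ is defined when $s(g)=t(h)$. A cyclic structure $\theta$ on $\mathcal G$ is a choice of $\theta_A\in\mathrm{Mor}(A,A)$ for every object $A$ with $f\theta_A=\theta_Bf$ for all $f\in\mathrm{Mor}(A,B)$. $C_\bullet(\mathcal G,\theta)$: $\mathcal G_0=\mathcal G^0$, $\mathcal G_1=\mathcal G^1$, and for $n\ge2$, $\mathcal G_n$ is the set of $[g_1,\dots,g_n]$ with $g_i\in\mathcal G^1$, $s(g_i)=t(g_{i+1})$. $C_n(\mathcal G,\theta)$ is the complex vector space with basis $\mathcal G_n$, with $\partial_0[g_1,\dots,g_n]=[g_2,\dots,g_n]$, $\partial_i[g_1,\dots,g_n]=[g_1,\dots,g_ig_{i+1},\dots,g_n]$ for $0<i<n$, $\partial_n[g_1,\dots,g_n]=[g_1,\dots,g_{n-1}]$ (for $n=1$: $\partial_0=s$, $\partial_1=t$); the degeneracy $\sigma_j$ ($0\le j\le n$) inserts the identity morphism between $g_j$ and $g_{j+1}$ (i.e. before $g_1$ if $j=0$, after $g_n$ if $j=n$; $\sigma_0(A)=\mathrm{Id}_A$ for $n=0$); $\tau[g_1,\dots,g_n]=[\theta_{s(g_n)}g_n^{-1}\cdots g_1^{-1},g_1,\dots,g_{n-1}]$ for $n\geq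 1$ and $\tau=\mathrm{Id}$ for $n=0$. $\mathcal B=\mathbb{C}\mathcal G^1$ and $C=\mathbb{C}\mathcal G^0$ are the coalgebras spanned by group-like elements: $\Delta(x)=x\otimes x$, $\varepsilon(x)=1$. $\mathcal B$ is a $C$-bicomodule by $g\mapsto t(g)\otimes g$ and $g\mapsto g\otimes s(g)$. $\square_C$ is the cotensor product. $\mathcal B^{\square_C(n+1)}$ is a right $\mathcal B$-comodule by $g_0\otimes\cdots\otimes g_n\mapsto g_0\otimes\cdots\otimes g_n\otimes g_0\cdots g_n$. ${}^\theta C$ denotes $C$ with left $\mathcal B$-coaction $c\mapsto\theta_c\otimes c$ ($c\in\mathcal G^0$) and right action $C\square_C\mathcal B\to C$, $c\cdot g=\varepsilon(c)s(g)$. *)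

(* Defs.v *)
From HB Require Import structures.
From mathcomp Require Import all_boot all_algebra.
From mathcomp Require Import boolp.
From mathcomp Require Export reals complex.
From mathcomp.multinomials Require Import freeg.

Set Implicit Arguments.
Unset Strict Implicit.
Unset Printing Implicit Defensive.

Import GRing.Theory.
Local Open Scope ring_scope.

(* The K-vector space with basis X is {freeg X / K}, with basis vectors << x >>;
   fglift f is the linear map sending << x >> to f x. *)

Section LinearExtension.
Context (K : fieldType) (X : choiceType) (M : lmodType K) (f : X -> M).

HB.instance Definition _ := GRing.isZmodMorphism.Build {freeg X / K} M
  (fglift f) (lift_is_additive f).

Fact fglift_is_scalable : scalable (fglift f : {freeg X / K} -> M).
Proof.
move=> a D; have sumE (c : K) : fglift f (c *: D) =
    \sum_(x <- dom D) (c * coeff x D) *: f x.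
  transitivity (fglift f (fgscale c D)); first by [].
  by rewrite /fgscale raddf_sum; apply: eq_bigr => x _; rewrite /= liftU.
rewrite sumE -[in RHS](scale1r D) sumE scaler_sumr.
by apply: eq_bigr => x _; rewrite scalerA mul1r.
Qed.

HB.instance Definition _ := GRing.isScalable.Build K {freeg X / K} M *:%R
  (fglift f) fglift_is_scalable.

Definition lin_ext : {linear {freeg X / K} -> M} := fglift f.
End LinearExtension.

Section Cotensor.
Context (K : fieldType).

(* K[X * Y] is used as the model of the tensor product of K[X] and K[Y]. *)
Definition tens (X Y : choiceType) (u : {freeg X / K}) (v : {freeg Y / K}) :
    {freeg (X * Y)%type / K} :=
  fglift (fun x => fglift (fun y => << (x, y) >>) v) u.

Definition tens_map (X X' Y Y' : choiceType)
    (f : {linear {freeg X / K} -> {freeg X' / K}})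
    (g : {linear {freeg Y / K} -> {freeg Y' / K}}) :
    {linear {freeg (X * Y)%type / K} -> {freeg (X' * Y')%type / K}} :=
  fglift (fun p => tens (f << p.1 >>) (g << p.2 >>)).

Definition tens_assoc (X Y Z : choiceType) :
    {linear {freeg (X * Y * Z)%type / K} -> {freeg (X * (Y * Z))%type / K}} :=
  fglift (fun p => << (p.1.1, (p.1.2, p.2)) >>).

(* The tensor product of subspaces V of K[X] and W of K[Y], inside K[X * Y]. *)
Definition tens_space (X Y : choiceType)
    (V : {pred {freeg X / K}}) (W : {pred {freeg Y / K}}) :
    {pred {freeg (X * Y)%type / K}} :=
  fun u => `[< exists2 s : seq ({freeg X / K} * {freeg Y / K}),
    all (fun p => (p.1 \in V) && (p.2 \in W)) s &
    u = \sum_(p <- s) tens p.1 p.2 >].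

(* The cotensor product over K[D] of the right comodule V, with coaction rho,
   and the left comodule W, with coaction lam; rho and lam are linear maps on
   the ambient spaces, of which only the restrictions to V and W matter. *)
Definition cotensor (X Y D : choiceType)
    (V : {pred {freeg X / K}})
    (rho : {linear {freeg X / K} -> {freeg (X * D)%type / K}})
    (W : {pred {freeg Y / K}})
    (lam : {linear {freeg Y / K} -> {freeg (D * Y)%type / K}}) :
    {pred {freeg (X * Y)%type / K}} :=
  fun u => (u \in tens_space V W) &&
    (tens_assoc X D Y (tens_map rho idfun u) == tens_map idfun lam u).

Fact tensZl (X Y : choiceType) a (u : {freeg X / K}) (v : {freeg Y / K}) :
  tens (a *: u) v = a *: tens u v.
Proof. by rewrite /tens linearZ. Qed.

Fact tensUU (X Y : choiceType) (x : X) (y : Y) :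
  tens << x >> << y >> = << (x, y) >> :> {freeg (X * Y)%type / K}.
Proof. by rewrite /tens !liftU !scale1r. Qed.

Fact tens_space_closed (X Y : choiceType) (V : {pred {freeg X / K}})
    (W : {pred {freeg Y / K}}) :
  submod_closed V -> submod_closed (tens_space V W).
Proof.
move=> [V0 VD]; split; first by apply/asboolP; exists [::]; rewrite ?big_nil.
move=> a _ _ /asboolP[s sP ->] /asboolP[t tP ->].
apply/asboolP; exists ([seq (a *: p.1, p.2) | p <- s] ++ t).
  rewrite all_cat tP andbT all_map; apply: sub_all sP => -[u v] /= /andP[uV ->].
  by rewrite andbT -[_ *: _]addr0 VD.
rewrite big_cat big_map /= scaler_sumr; congr (_ + _).
by apply: eq_bigr => p _; rewrite tensZl.
Qed.

Fact cotensor_closed (X Y D : choiceType) (V : {pred {freeg X / K}}) rho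
    (W : {pred {freeg Y / K}}) lam :
  submod_closed V -> submod_closed (@cotensor X Y D V rho W lam).
Proof.
move=> /(@tens_space_closed _ _ _ W)[T0 TD]; split.
  by apply/andP; split; [exact: T0 | rewrite !linear0].
move=> a u v /andP[uT /eqP eu] /andP[vT /eqP ev].
by apply/andP; split; [exact: TD | rewrite !linearP eu ev].
Qed.

Fact cotensorU (X Y D : choiceType) (V : {pred {freeg X / K}})
    (rho : {linear {freeg X / K} -> {freeg (X * D)%type / K}})
    (W : {pred {freeg Y / K}})
    (lam : {linear {freeg Y / K} -> {freeg (D * Y)%type / K}}) x y d :
  << x >> \in V -> << y >> \in W ->
  rho << x >> = << (x, d) >> -> lam << y >> = << (d, y) >> ->
  << (x, y) >> \in cotensor V rho W lam.
Proof.
move=> xV yW ex ey; apply/andP; split.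
  apply/asboolP; exists [:: (<< x >>, << y >>)]; first by rewrite /= xV yW.
  by rewrite big_seq1 tensUU.
rewrite /tens_map /= !liftU !scale1r /= ex ey !tensUU.
by rewrite /tens_assoc /= liftU scale1r.
Qed.

End Cotensor.

Definition is_basis (K : fieldType) (V : lmodType K) (X : choiceType)
    (b : X -> V) : Prop :=
  (forall (s : seq X) (a : X -> K), uniq s ->
     \sum_(x <- s) a x *: b x = 0 -> forall x, x \in s -> a x = 0) /\
  (forall v, exists (s : seq X) (a : X -> K), v = \sum_(x <- s) a x *: b x).

(* Faces and degeneracies are indexed by natural numbers; only face n i with
   i <= n.+1, and degen n j with j <= n, are part of the structure. *)
Record cyclic_ops (K : fieldType) (V : nat -> lmodType K) := CyclicOps {
  face : forall n : nat, nat -> {linear V n.+1 -> V n};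
  degen : forall n : nat, nat -> {linear V n -> V n.+1};
  cyc : forall n : nat, {linear V n -> V n} }.

Definition is_cyclic_module (K : fieldType) (V : nat -> lmodType K)
    (A : cyclic_ops V) : Prop :=
  [/\ forall n i j (x : V n.+2), (i < j <= n.+2)%N ->
        face A n i (face A n.+1 j x) = face A n j.-1 (face A n.+1 i x),
      forall n i j (x : V n), (i <= j <= n)%N ->
        degen A n.+1 i (degen A n j x) = degen A n.+1 j.+1 (degen A n i x) &
   [/\ forall n i j (x : V n.+1), (i < j <= n.+1)%N ->
         face A n.+1 i (degen A n.+1 j x) = degen A n j.-1 (face A n i x),
       forall n j (x : V n), (j <= n)%N ->
         face A n j (degen A n j x) = x,
       forall n j (x : V n), (j <= n)%N ->
         face A n j.+1 (degen A n j x) = x &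
       forall n i j (x : V n.+1), (j.+1 < i <= n.+2)%N ->
         face A n.+1 i (degen A n.+1 j x) = degen A n j (face A n i.-1 x)]]
  /\ [/\ forall n i (x : V n.+1), (0 < i <= n.+1)%N ->
         face A n i (cyc A n.+1 x) = cyc A n (face A n i.-1 x),
       forall n (x : V n.+1),
         face A n 0 (cyc A n.+1 x) = face A n n.+1 x,
       forall n i (x : V n), (0 < i <= n)%N ->
         degen A n i (cyc A n x) = cyc A n.+1 (degen A n i.-1 x),
       forall n (x : V n),
         degen A n 0 (cyc A n x) = cyc A n.+1 (cyc A n.+1 (degen A n n x)) &
       forall n (x : V n), iter n.+1 (cyc A n) x = x].

Definition is_cyclic_morphism (K : fieldType) (V W : nat -> lmodType K)
    (A : cyclic_ops V) (B : cyclic_ops W)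
    (f : forall n, {linear V n -> W n}) : Prop :=
  [/\ forall n i (x : V n.+1), (i <= n.+1)%N ->
        f n (face A n i x) = face B n i (f n.+1 x),
      forall n j (x : V n), (j <= n)%N ->
        f n.+1 (degen A n j x) = degen B n j (f n x) &
      forall n (x : V n), f n (cyc A n x) = cyc B n (f n x)].

(* The maps f n form an isomorphism of cyclic modules, with inverse g n. *)
Definition is_cyclic_iso (K : fieldType) (V W : nat -> lmodType K)
    (A : cyclic_ops V) (B : cyclic_ops W)
    (f : forall n, {linear V n -> W n}) (g : forall n, {linear W n -> V n}) :
    Prop :=
  [/\ is_cyclic_module A, is_cyclic_module B, is_cyclic_morphism A B f &
      forall n, cancel (f n) (g n) /\ cancel (g n) (f n)].

(* gmul g h is meaningful only when src g = tgt h. *)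
Record groupoid := Groupoid {
  ob : choiceType;
  mor : choiceType;
  src : mor -> ob;
  tgt : mor -> ob;
  idm : ob -> mor;
  gmul : mor -> mor -> mor;
  ginv : mor -> mor;
  src_idm : forall A, src (idm A) = A;
  tgt_idm : forall A, tgt (idm A) = A;
  src_gmul : forall g h, src g = tgt h -> src (gmul g h) = src h;
  tgt_gmul : forall g h, src g = tgt h -> tgt (gmul g h) = tgt g;
  gmulA : forall g h k, src g = tgt h -> src h = tgt k ->
    gmul g (gmul h k) = gmul (gmul g h) k;
  gmul_idl : forall g, gmul (idm (tgt g)) g = g;
  gmul_idr : forall g, gmul g (idm (src g)) = g;
  src_ginv : forall g, src (ginv g) = tgt g;
  tgt_ginv : forall g, tgt (ginv g) = src g;
  gmulVg : forall g, gmul (ginv g) g = idm (src g);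
  gmulgV : forall g, gmul g (ginv g) = idm (tgt g) }.

Record cyclic_structure (G : groupoid) := CyclicStructure {
  theta :> ob G -> mor G;
  src_theta : forall A, src (theta A) = A;
  tgt_theta : forall A, tgt (theta A) = A;
  theta_nat : forall f, gmul f (theta (src f)) = gmul (theta (tgt f)) f }.

Section Sequences.
Context (G : groupoid).
Implicit Types (g h x : mor G) (r s : seq (mor G)).

Definition composable g h := src g == tgt h.

(* The product g h_1 ... h_k, where r = [:: h_1; ...; h_k]. *)
Fixpoint gprod g r := if r is h :: r' then gmul g (gprod h r') else g.

(* The entries i and i.+1 (counted from 0) are replaced by their product. *)
Fixpoint contract i s :=
  if s is g :: ((h :: r) as s') then
    if i is i'.+1 then g :: contract i' s' else gmul g h :: r
  else s.

(* An identity is inserted just after the entry j (counted from 0) of g :: r. *)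
Fixpoint insert_id j g r :=
  match j, r with
  | j'.+1, h :: r' => g :: insert_id j' h r'
  | _, _ => g :: idm (src g) :: r
  end.

Fact size_contract i s : (i.+1 < size s)%N -> size (contract i s) = (size s).-1.
Proof.
elim: i s => [|i IH] [|g [|h r]] //= ir.
by congr _.+1; rewrite IH.
Qed.

Fact size_insert_id j g r : size (insert_id j g r) = (size r).+2.
Proof. by elim: j g r => [|j IH] g [|h r] //=; rewrite IH. Qed.

Fact path_eq_tgt x y s : src x = src y -> path composable x s = path composable y s.
Proof. by case: s => //= h r e; rewrite /composable e. Qed.

Fact tgt_gprod g r : path composable g r -> tgt (gprod g r) = tgt g.
Proof.
elim: r g => //= h r IH g /andP[/eqP gh hr].
by rewrite tgt_gmul // IH.
Qed.

Fact src_gprod g r : path composable g r -> src (gprod g r) = src (last g r).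
Proof.
elim: r g => //= h r IH g /andP[/eqP gh hr].
by rewrite src_gmul ?IH // tgt_gprod.
Qed.

Fact gprod_rcons g r x : path composable g (rcons r x) ->
  gprod g (rcons r x) = gmul (gprod g r) x.
Proof.
elim: r g => //= h r IH g /andP[/eqP gh]; rewrite rcons_path => /andP[hr rx].
rewrite IH; last by rewrite rcons_path hr.
by rewrite gmulA ?tgt_gprod ?src_gprod // (eqP rx).
Qed.

Fact contract_path i x s : path composable x s -> (i.+1 < size s)%N ->
  [/\ path composable x (contract i s),
      src (last x (contract i s)) = src (last x s),
      size (contract i s) = (size s).-1 &
      gprod x (contract i s) = gprod x s].
Proof.
elim: i x s => [|i IH] x [|g [|h r]] //= /and3P[xg gh hr] ir.
  have e := eqP gh; split=> //.
  - by rewrite /composable tgt_gmul // -/(composable x g) xg; rewrite (path_eq_tgt r (src_gmul e)).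
  - by case: r {ir} hr => //= _; rewrite src_gmul.
  - congr gmul; case: r hr {ir} => //= k r /andP[/eqP hk kr].
    by rewrite gmulA // tgt_gprod.
case: (IH g (h :: r)) => //=; first by rewrite gh.
by move=> -> -> -> ->; rewrite xg.
Qed.

Fact path_insert_idm g r : path composable g r ->
  path composable g (idm (src g) :: r) /\ gprod g (idm (src g) :: r) = gprod g r.
Proof.
case: r => [|h r] /=; rewrite /composable tgt_idm eqxx ?gmul_idr ?src_idm //.
by move=> /andP[/eqP gh hr]; rewrite gh eqxx -(tgt_gprod hr) gmul_idl.
Qed.

Fact insert_id_path j g r : path composable g r ->
  exists r', [/\ insert_id j g r = g :: r', path composable g r',
                 gprod g r' = gprod g r & size r' = (size r).+1].
Proof.
elim: j g r => [|j IH] g r gr.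
  by have [p e] := path_insert_idm gr; exists (idm (src g) :: r).
case: r gr => [|h r] gr.
  by have [p e] := path_insert_idm gr; exists [:: idm (src g)].
move: gr => /= /andP[gh hr]; have [r' [-> p' e' s']] := IH h r hr.
by exists (h :: r'); rewrite /= gh p' e' s'.
Qed.

Fact path_rev_ginv x g r : path composable g r -> src x = src (last g r) ->
  path composable x (rev (map (@ginv G) (g :: r))).
Proof.
elim/last_ind: r x => [|r k IH] x /=.
  by move=> _ e; rewrite /composable e tgt_ginv eqxx.
rewrite rcons_path last_rcons => /andP[gr rk] e.
rewrite map_rcons -rcons_cons rev_rcons /= IH //; last by rewrite src_ginv (eqP rk).
by rewrite /composable e tgt_ginv eqxx.
Qed.
End Sequences.

Section Nerve.
Context (G : groupoid) (th : cyclic_structure G).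

(* nerve m.+1 consists of the composable sequences [g_1, ..., g_(m.+1)]. *)
Definition nerve (n : nat) : choiceType :=
  match n with
  | 0 => ob G
  | m.+1 => {s : m.+1.-tuple (mor G) | sorted (@composable G) s}
  end.

Definition nerve_mk m (s : seq (mor G))
    (sP : (size s == m.+1) && sorted (@composable G) s) : nerve m.+1 :=
  exist (fun t : m.+1.-tuple (mor G) => sorted (@composable G) t)
    (Tuple (proj1 (andP sP))) (proj2 (andP sP)).

Definition nerve_face_seq i (s : seq (mor G)) : seq (mor G) :=
  if s is g :: r then
    if i == 0%N then r
    else if (i <= size r)%N then contract i.-1 s
    else belast g r
  else [::].

Definition nerve_degen_seq j (s : seq (mor G)) : seq (mor G) :=
  if s is g :: r then
    if j is j'.+1 then insert_id j' g r else idm (tgt g) :: s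
  else [::].

Definition nerve_cyc_seq (s : seq (mor G)) : seq (mor G) :=
  if s is g :: r then
    gprod (th (src (last g r))) (rev (map (@ginv G) s)) :: belast g r
  else [::].

Fact path_belast (x g : mor G) r : src x = tgt g -> path (@composable G) g r ->
  path (@composable G) x (belast g r).
Proof.
elim: r x g => //= h r IH x g e /andP[/eqP gh hr].
by rewrite IH // /composable e eqxx.
Qed.

Fact sorted_idm (g : mor G) s : path (@composable G) (idm (tgt g)) s ->
  sorted (@composable G) s.
Proof. by case: s => //= h s /andP[]. Qed.

Fact nerve_faceP m i (t : nerve m.+2) :
  (size (nerve_face_seq i (sval t)) == m.+1) &&
  sorted (@composable G) (nerve_face_seq i (sval t)).
Proof.
case: t => t /=; case/tupleP: t => g [r /= /eqP rs] gr.
have xg : path (@composable G) (idm (tgt g)) (g :: r).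
  by rewrite /= /composable src_idm eqxx.
case: (i =P 0%N) => [_|/eqP i0]; first by rewrite rs eqxx (path_sorted gr).
case: leqP => [ir|_].
  case: (@contract_path G i.-1 (idm (tgt g)) (g :: r)) => //=.
    by case: i i0 ir.
  by move=> /sorted_idm -> // _ -> _; rewrite rs eqxx.
rewrite size_belast rs eqxx.
by apply: (@sorted_idm g _); apply: path_belast; rewrite ?src_idm.
Qed.

Fact nerve_degenP m j (t : nerve m.+1) :
  (size (nerve_degen_seq j (sval t)) == m.+2) &&
  sorted (@composable G) (nerve_degen_seq j (sval t)).
Proof.
case: t => t /=; case/tupleP: t => g [r /= /eqP rs] gr.
case: j => [|j] /=; first by rewrite rs gr /composable src_idm !eqxx.
by have [r' [-> p _ s']] := insert_id_path j gr; rewrite /= s' rs p eqxx.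
Qed.

Fact nerve_cycP m (t : nerve m.+1) :
  (size (nerve_cyc_seq (sval t)) == m.+1) &&
  sorted (@composable G) (nerve_cyc_seq (sval t)).
Proof.
case: t => t /=; case/tupleP: t => g [r /= /eqP rs] gr.
rewrite size_belast rs eqxx /=; apply: path_belast => //.
rewrite src_gprod; first by rewrite rev_cons last_rcons src_ginv.
by apply: path_rev_ginv gr _; rewrite src_theta.
Qed.

Definition nerve_face n i : nerve n.+1 -> nerve n :=
  match n return nerve n.+1 -> nerve n with
  | 0 => fun t => if i == 0%N then src (thead (sval t)) else tgt (thead (sval t))
  | m.+1 => fun t => nerve_mk (nerve_faceP i t)
  end.

Fact nerve_idP A : (size [:: idm A] == 1%N) && sorted (@composable G) [:: idm A].
Proof. by []. Qed.

Definition nerve_degen n j : nerve n -> nerve n.+1 :=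
  match n return nerve n -> nerve n.+1 with
  | 0 => fun A => nerve_mk (nerve_idP A)
  | m.+1 => fun t => nerve_mk (nerve_degenP j t)
  end.

Definition nerve_cyc n : nerve n -> nerve n :=
  match n return nerve n -> nerve n with
  | 0 => id
  | m.+1 => fun t => nerve_mk (nerve_cycP t)
  end.

Context (K : fieldType).

Definition CG (n : nat) : lmodType K := {freeg (nerve n) / K}.

Definition CG_ops : cyclic_ops CG := @CyclicOps K CG
  (fun n i => lin_ext (fun x => << @nerve_face n i x >>))
  (fun n j => lin_ext (fun x => << @nerve_degen n j x >>))
  (fun n => lin_ext (fun x => << @nerve_cyc n x >>)).

End Nerve.

Section Coalgebra.
Context (G : groupoid) (th : cyclic_structure G) (K : fieldType).

(* The right coaction g |-> g (x) s(g) of the coalgebra C on B. *)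
Definition B_rcoact :
    {linear {freeg (mor G) / K} -> {freeg (mor G * ob G)%type / K}} :=
  lin_ext (fun g => << (g, src g) >>).

(* The left coaction of C on a cotensor power of B, through the first factor. *)
Definition Bpow_lcoact n :
    {linear {freeg (n.+1.-tuple (mor G)) / K} ->
            {freeg (ob G * n.+1.-tuple (mor G))%type / K}} :=
  lin_ext (fun t => << (tgt (thead t), t) >>).
Arguments Bpow_lcoact : clear implicits.

(* Splits off the first of n.+2 tensor factors. *)
Definition Bpow_split n :
    {linear {freeg (n.+2.-tuple (mor G)) / K} ->
            {freeg (mor G * n.+1.-tuple (mor G))%type / K}} :=
  lin_ext (fun t => << (thead t, behead_tuple t) >>).
Arguments Bpow_split : clear implicits.

(* The cotensor power of B over C with n.+1 factors, inside the tensor power of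
   B, the space with basis n.+1.-tuple (mor G). *)
Fixpoint Bpow n : {pred {freeg (n.+1.-tuple (mor G)) / K}} :=
  match n with
  | 0 => predT
  | m.+1 => fun u => Bpow_split m u \in
      cotensor predT B_rcoact (@Bpow m) (Bpow_lcoact m)
  end.
Arguments Bpow : clear implicits.

(* The right coaction of B; on non-composable tuples, which lie outside Bpow n,
   the value is irrelevant. *)
Definition Bpow_rcoact n :
    {linear {freeg (n.+1.-tuple (mor G)) / K} ->
            {freeg (n.+1.-tuple (mor G) * mor G)%type / K}} :=
  lin_ext (fun t => << (t, gprod (thead t) (behead t)) >>).
Arguments Bpow_rcoact : clear implicits.

(* The left coaction c |-> theta_c (x) c of B on C. *)
Definition C_lcoact :
    {linear {freeg (ob G) / K} -> {freeg (mor G * ob G)%type / K}} :=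
  lin_ext (fun c => << (th c, c) >>).

Definition CB_pred n : {pred {freeg (n.+1.-tuple (mor G) * ob G)%type / K}} :=
  cotensor (Bpow n) (Bpow_rcoact n) predT C_lcoact.

Fact Bpow_closed n : submod_closed (Bpow n).
Proof.
have PT (V : lmodType K) : submod_closed (predT : {pred V}) by [].
case: n => [|n]; first exact: PT.
have [T0 TD] := cotensor_closed B_rcoact (Bpow n) (Bpow_lcoact n)
  (PT {freeg (mor G) / K}).
split=> [|a u v uP vP]; first by rewrite [_ \in _]/(_ \in _) /in_mem /= linear0.
by have := TD a _ _ uP vP; rewrite -linearP.
Qed.

Fact CB_closed n : submod_closed (@CB_pred n).
Proof. exact: cotensor_closed (Bpow_closed n). Qed.
HB.instance Definition _ n :=
  GRing.isSubmodClosed.Build K _ (@CB_pred n) (@CB_closed n).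

Definition CB_type n := {u | u \in @CB_pred n}.
HB.instance Definition _ n := SubChoice.on (CB_type n).
HB.instance Definition _ n := [SubChoice_isSubLmodule of CB_type n by <:].

Definition CB n : lmodType K := CB_type n.

(* The condition for s = [g_0, ..., g_n] and c to form a symbol
   [g_0, ..., g_n, c]; cycle also requires s(g_n) = t(g_0). *)
Definition symb_ok (s : seq (mor G)) (c : ob G) :=
  if s is g :: r then cycle (@composable G) s && (gprod g r == th c) else false.

Definition symb n := {p : n.+1.-tuple (mor G) * ob G | symb_ok p.1 p.2}.

Definition symb_mk n (s : seq (mor G)) (c : ob G)
    (sP : (size s == n.+1) && symb_ok s c) : symb n :=
  exist (fun p : n.+1.-tuple (mor G) * ob G => symb_ok p.1 p.2)
    (Tuple (proj1 (andP sP)), c) (proj2 (andP sP)).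

Fact symb_okE g r c :
  symb_ok (g :: r) c = path (@composable G) g r && (gprod g r == th c).
Proof.
rewrite /symb_ok /cycle rcons_path -andbA.
have [gr|//] := boolP (path _ g r); rewrite andTb.
case: eqP => [e|_]; last by rewrite andbF.
rewrite andbT /composable -(src_gprod gr) e src_theta.
by rewrite -(tgt_gprod gr) e tgt_theta eqxx.
Qed.

Fact Bpow_in n (t : n.+1.-tuple (mor G)) :
  path (@composable G) (thead t) (behead t) -> << t >> \in Bpow n.
Proof.
elim: n t => [|n IH] t; first by [].
case/tupleP: t => g t; rewrite theadE /= => p.
rewrite [_ \in _]/(_ \in _) /in_mem /= liftU scale1r theadE.
have -> : behead_tuple [tuple of g :: t] = t by exact: val_inj.
case/tupleP: t p => h r /= /andP[/eqP gh hr].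
apply: (@cotensorU _ _ _ _ _ _ _ _ _ _ (src g)); first by [].
- by apply: IH; rewrite theadE.
- by rewrite /= liftU scale1r.
- by rewrite /= liftU scale1r theadE gh.
Qed.

Fact symb_in n (x : symb n) : << sval x >> \in @CB_pred n.
Proof.
case: x => -[t c] /= tc; have [tp /eqP e] : path (@composable G) (thead t) (behead t)
    /\ gprod (thead t) (behead t) == th c.
  by case/tupleP: t tc => g r; rewrite theadE symb_okE => /andP[].
apply: (@cotensorU _ _ _ _ _ _ _ _ _ _ (th c)); rewrite ?Bpow_in //=.
- by rewrite liftU scale1r e.
- by rewrite liftU scale1r.
Qed.

(* The vector g_0 (x) ... (x) g_n (x) c of the cotensor product. *)
Definition symb_vec n (x : symb n) : CB n :=
  exist (fun u => u \in @CB_pred n) << sval x >> (symb_in x).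

(* The linear map on CB n with value f x on each symbol x; see symb_extE. *)
Definition symb_ext n (M : lmodType K) (f : symb n -> M) (u : CB n) : M :=
  lin_ext (fun p => oapp f 0 (insub p)) (val u).

Fact symb_ext_linear n (M : lmodType K) (f : symb n -> M) :
  linear (symb_ext f).
Proof. by move=> a u v; rewrite /symb_ext !linearP. Qed.
HB.instance Definition _ n (M : lmodType K) (f : symb n -> M) :=
  GRing.isLinear.Build K (CB n) M *:%R (symb_ext f) (symb_ext_linear f).

Fact symb_extE n (M : lmodType K) (f : symb n -> M) x :
  symb_ext f (symb_vec x) = f x.
Proof. by rewrite /symb_ext /= liftU scale1r valK. Qed.

(* The right action c . g = epsilon(c) s(g) of B on C, where epsilon(c) = 1. *)
Definition C_ract (c : ob G) (g : mor G) : ob G := src g.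

Definition symb_face_seq i (s : seq (mor G)) : seq (mor G) :=
  if s is g :: r then
    if (i < size r)%N then contract i s
    else gmul (last g r) g :: behead (belast g r)
  else [::].

Definition symb_face_ob i (s : seq (mor G)) (c : ob G) : ob G :=
  if s is g :: r then
    if (i < size r)%N then c else C_ract c (ginv (last g r))
  else c.

Definition symb_degen_seq j (s : seq (mor G)) : seq (mor G) :=
  if s is g :: r then insert_id j g r else [::].

Definition symb_cyc_seq (s : seq (mor G)) : seq (mor G) :=
  if s is g :: r then last g r :: belast g r else [::].

Definition symb_cyc_ob (s : seq (mor G)) (c : ob G) : ob G :=
  if s is g :: r then C_ract c (ginv (last g r)) else c.

Fact gprod_rot g r k c : path (@composable G) g (rcons r k) ->
  gprod g (rcons r k) = th c ->
  src k = tgt g /\ gmul k (gprod g r) = th (tgt k).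
Proof.
move=> p e; have := p; rewrite rcons_path => /andP[gr /eqP rk].
have kc : src k = c by rewrite -(src_theta th c) -e src_gprod // last_rcons.
have kg : src k = tgt g by rewrite kc -(tgt_theta th c) -e tgt_gprod.
split=> //; rewrite gprod_rcons // in e.
have Pk : src (gprod g r) = tgt k by rewrite src_gprod.
have kP : src k = tgt (gprod g r) by rewrite tgt_gprod.
have e1 : gmul (gmul k (gprod g r)) k = gmul (th (tgt k)) k.
  by rewrite -gmulA // e -kc theta_nat.
have cK x : src x = tgt k -> gmul (gmul x k) (ginv k) = x.
  by move=> xk; rewrite -gmulA ?tgt_ginv // gmulgV -xk gmul_idr.
by rewrite -(cK (th _)) ?src_theta // -e1 cK // src_gmul.
Qed.

Fact symb_faceP n i (x : symb n.+1) :
  (size (symb_face_seq i (sval x).1) == n.+1) &&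
  symb_ok (symb_face_seq i (sval x).1) (symb_face_ob i (sval x).1 (sval x).2).
Proof.
case: x => -[t c]; case/tupleP: t => g [r /= /eqP rs].
rewrite -/(symb_ok (g :: r) c) symb_okE => /andP[gr /eqP e].
case: ltnP => [ir|_].
  have xg : path (@composable G) (idm (tgt g)) (g :: r).
    by rewrite /= /composable src_idm eqxx.
  have [|] := @contract_path G i (idm (tgt g)) (g :: r) xg; first by [].
  case: (contract i (g :: r)) => [|h s] /=; first by rewrite rs.
  move=> /andP[/eqP hs ps] _ ->; rewrite rs eqxx -/(symb_ok (h :: s) c) symb_okE ps.
  rewrite src_idm in hs.
  by rewrite -(tgt_gprod gr) gmul_idl (tgt_gprod gr) hs -(tgt_gprod ps) gmul_idl e => ->/=.
case/lastP: r rs gr e => // r k rs gr e.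
have [kg kP] := gprod_rot gr e; rewrite last_rcons belast_rcons /=.
rewrite size_rcons in rs; rewrite rs eqxx -/(symb_ok (gmul k g :: r) _) symb_okE.
move: gr; rewrite rcons_path => /andP[gr _].
rewrite (path_eq_tgt r (src_gmul kg)) gr /C_ract src_ginv -kP /=.
case: r {rs e kP} gr => [|h r] //= /andP[/eqP gh hr].
by rewrite gmulA ?tgt_gprod.
Qed.

Fact symb_degenP n j (x : symb n) :
  (size (symb_degen_seq j (sval x).1) == n.+2) &&
  symb_ok (symb_degen_seq j (sval x).1) (sval x).2.
Proof.
case: x => -[t c]; case/tupleP: t => g [r /= /eqP rs].
rewrite -/(symb_ok (g :: r) c) symb_okE => /andP[gr e].
have [r' [-> p e' s']] := insert_id_path j gr.
by rewrite -/(symb_ok _ c) symb_okE /= s' rs p e' e eqxx.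
Qed.

Fact symb_cycP n (x : symb n) :
  (size (symb_cyc_seq (sval x).1) == n.+1) &&
  symb_ok (symb_cyc_seq (sval x).1) (symb_cyc_ob (sval x).1 (sval x).2).
Proof.
case: x => -[t c]; case/tupleP: t => g [r /= /eqP rs].
rewrite -/(symb_ok (g :: r) c) symb_okE => /andP[gr /eqP e].
rewrite -/(symb_ok (_ :: _) _) symb_okE size_belast rs eqxx /C_ract src_ginv /=.
case/lastP: r gr e {rs} => [|r k] gr e /=; first by rewrite /= in e; rewrite e tgt_theta.
have [kg kP] := gprod_rot gr e; rewrite last_rcons belast_rcons /=.
move: gr; rewrite rcons_path => /andP[-> _].
by rewrite kP /composable kg !eqxx.
Qed.

Definition symb_face n i (x : symb n.+1) : symb n := symb_mk (symb_faceP i x).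
Definition symb_degen n j (x : symb n) : symb n.+1 := symb_mk (symb_degenP j x).
Definition symb_cyc n (x : symb n) : symb n := symb_mk (symb_cycP x).

Definition CB_ops : cyclic_ops CB := @CyclicOps K CB
  (fun n i => symb_ext (fun x => symb_vec (@symb_face n i x)))
  (fun n j => symb_ext (fun x => symb_vec (@symb_degen n j x)))
  (fun n => symb_ext (fun x => symb_vec (@symb_cyc n x))).

Fact symb_nerveP m (x : symb m.+1) :
  (size (behead (sval x).1) == m.+1) &&
  sorted (@composable G) (behead (sval x).1).
Proof.
case: x => -[t c]; case/tupleP: t => g [r /= /eqP rs] ok /=; move: ok.
rewrite -/(symb_ok (g :: r) c) symb_okE => /andP[gr _].
by rewrite rs eqxx (path_sorted gr).
Qed.

(* [g_0, ..., g_n, c] |-> [g_1, ..., g_n], and [g_0, c] |-> c. *)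
Definition symb_nerve n : symb n -> nerve G n :=
  match n return symb n -> nerve G n with
  | 0 => fun x => (sval x).2
  | m.+1 => fun x => nerve_mk (symb_nerveP x)
  end.

Definition nerve_symb_seq (s : seq (mor G)) : seq (mor G) :=
  if s is g :: r then gmul (th (src (last g r))) (ginv (gprod g r)) :: s
  else [::].

Fact nerve_symbP m (t : nerve G m.+1) :
  (size (nerve_symb_seq (sval t)) == m.+2) &&
  symb_ok (nerve_symb_seq (sval t))
    (src (last (thead (sval t)) (behead (sval t)))).
Proof.
case: t => t /=; case/tupleP: t => g r gr; rewrite theadE /= in gr *.
have := symb_okE (gmul (th (src (last g r))) (ginv (gprod g r))) (g :: r)
  (src (last g r)); rewrite /= size_tuple eqxx gr => ->.
have tP : src (th (src (last g r))) = tgt (ginv (gprod g r)).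
  by rewrite src_theta tgt_ginv src_gprod.
rewrite /composable src_gmul // src_ginv tgt_gprod // eqxx /=.
rewrite -gmulA ?src_ginv // gmulVg src_gprod //.
by rewrite -{2}(src_theta th (src (last g r))) gmul_idr.
Qed.

Fact nerve_symb0P (A : ob G) : (size [:: th A] == 1%N) && symb_ok [:: th A] A.
Proof. by rewrite symb_okE /= eqxx. Qed.

(* [g_1, ..., g_n] |->
     [theta_(s(g_n)) (g_1 ... g_n)^-1, g_1, ..., g_n, s(g_n)],
   and A |-> [theta_A, A]. *)
Definition nerve_symb n : nerve G n -> symb n :=
  match n return nerve G n -> symb n with
  | 0 => fun A => symb_mk (nerve_symb0P A)
  | m.+1 => fun t => symb_mk (nerve_symbP t)
  end.

Definition CB_to_CG n : {linear CB n -> CG G K n} :=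
  symb_ext (fun x => << symb_nerve x >> : {freeg (nerve G n) / K}).

Definition CG_to_CB n : {linear CG G K n -> CB n} :=
  lin_ext (fun t => symb_vec (nerve_symb t)).

End Coalgebra.

(* Main.v *)
From HB Require Import structures.
Require Import Defs.
From mathcomp Require Import all_boot all_algebra reals complex.
From mathcomp Require Import zify boolp.
From mathcomp.multinomials Require Import freeg.

Set Implicit Arguments.
Unset Strict Implicit.
Unset Printing Implicit Defensive.

Import GRing.Theory.
Local Open Scope ring_scope.

(** A symbol is determined by its sequence [g_0, ..., g_n], a cyclically
composable sequence on which [tau] acts by rotation and the last face is the
face 0 of the rotated sequence; the cyclic identities then reduce to identities
between contractions and insertions of identities. A vector of the cotensor
product has no coefficient outside the symbols, because the two coactions send
basis vectors to basis vectors: comparing the coefficients of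
[(x, (d x, y))] forces [d x = e y] on the support. Hence the symbols form a
basis and everything can be checked on them. The cyclic identities of
[C(G, theta)] are not proved directly but transported along the bijection. *)

(** * Contractions, insertions of identities and rotations of sequences of morphisms *)

Section SequenceIdentities.
Context (G : groupoid).
Implicit Types (g h k x : mor G) (i j : nat) (r s : seq (mor G)).

Lemma contractS i g s : contract i.+1 (g :: s) = g :: contract i s.
Proof. by case: s => [|h r] //=; case: i. Qed.

(** The tail is nonempty because [symb_degen_seq] leaves the empty sequence unchanged, whereas a
    one-entry sequence receives an identity at its end for every index. *)
Lemma symb_degen_seqS j g s : (0 < size s)%N ->
  symb_degen_seq j.+1 (g :: s) = g :: symb_degen_seq j s.
Proof. by case: s. Qed.

Lemma size_symb_degen_seq j s : (0 < size s)%N ->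
  size (symb_degen_seq j s) = (size s).+1.
Proof. by case: s => //= g r _; rewrite size_insert_id. Qed.

Lemma contract_rcons i s k : (i.+1 < size s)%N ->
  contract i (rcons s k) = rcons (contract i s) k.
Proof.
elim: i s => [|i IH] [|g [|h r]] //= ir.
by rewrite -rcons_cons IH.
Qed.

Lemma symb_degen_seq_rcons j s k : (j < size s)%N ->
  symb_degen_seq j (rcons s k) = rcons (symb_degen_seq j s) k.
Proof.
elim: j s => [|j IH] [|g s] //; rewrite ltnS => js.
have s0 : (0 < size s)%N by apply: leq_trans js.
by rewrite rcons_cons symb_degen_seqS ?size_rcons // symb_degen_seqS // IH.
Qed.

Lemma symb_cyc_seq_rcons s k : symb_cyc_seq (rcons s k) = k :: s.
Proof. by case: s => [|g s] //=; rewrite last_rcons belast_rcons. Qed.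

(** Sizes and cyclic composability after [tau] thereby become known facts about rotations. *)
Lemma symb_cyc_seqE s : symb_cyc_seq s = rotr 1 s.
Proof.
by case/lastP: s => // s k; rewrite symb_cyc_seq_rcons rotr1_rcons.
Qed.

Lemma symb_face_seqE i s : (i.+1 < size s)%N -> symb_face_seq i s = contract i s.
Proof. by case: s => //= g r ir; rewrite ifT. Qed.

(** Rotation makes g_n and g_0 the first two entries, so the product g_n g_0 of the last face
    becomes an ordinary contraction. *)
Lemma symb_face_seq_last s : (1 < size s)%N ->
  symb_face_seq (size s).-1 s = contract 0 (symb_cyc_seq s).
Proof. by case: s => [|g [|h r]] //= _; rewrite ltnn. Qed.

(** Once the common prefix is stripped, [i] is 0. The case [j = 1] is associativity, made available
    by composability; for larger [j] the contracted pairs are disjoint. *)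
Lemma contract_contract i j s : (i < j)%N -> (j.+1 < size s)%N ->
  sorted (@composable G) s ->
  contract i (contract j s) = contract j.-1 (contract i s).
Proof.
elim: i j s => [|i IH] [|j] [|g s] // ij; rewrite ltnS => js; rewrite !contractS.
  case: s js => // h s; case: j {ij} => [|j].
    by case: s => // k s _ /and3P[/eqP gh /eqP hk _] /=; rewrite gmulA.
  by rewrite contractS /=; case: s => // k s; rewrite !contractS.
case: j ij js => // j ij js /path_sorted p.
by rewrite !contractS IH.
Qed.

Lemma symb_degen_degen_seq i j s : (i <= j < size s)%N ->
  symb_degen_seq i (symb_degen_seq j s) = symb_degen_seq j.+1 (symb_degen_seq i s).
Proof.
elim: i j s => [|i IH] [|j] [|g s] //.
- by move=> _ /=; rewrite src_idm.
- by case: s.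
rewrite !ltnS => /andP[ij js]; have s0 : (0 < size s)%N by apply: leq_trans js.
by rewrite !symb_degen_seqS ?size_symb_degen_seq // IH ?ij.
Qed.

(** The delicate case, after stripping the prefix, has the identity just after the second factor of
    a product g h: it is the right one because g h and h have the same source. *)
Lemma contract_symb_degen_lt i j s : (i < j < size s)%N ->
  sorted (@composable G) s ->
  contract i (symb_degen_seq j s) = symb_degen_seq j.-1 (contract i s).
Proof.
elim: i j s => [|i IH] [|j] [|g s] //.
  rewrite !ltnS => /andP[_ js] p; have s0 : (0 < size s)%N by apply: leq_trans js.
  rewrite symb_degen_seqS //; case: s js p {s0} => // h s js /andP[/eqP gh _].
  case: j js => [|j js]; first by rewrite /= src_gmul.
  by rewrite symb_degen_seqS /=; case: s js.
case: j => [|j] //.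
rewrite !ltnS => /andP[ij js] /path_sorted p; have s0 : (0 < size s)%N by apply: leq_trans js.
have is1 : (i.+1 < size s)%N by apply: leq_trans js; rewrite ltnS.
rewrite symb_degen_seqS // !contractS symb_degen_seqS; last first.
  by rewrite size_contract //; case: (size s) is1 => [|[]].
by rewrite IH // ltnS ij.
Qed.

Lemma contract_symb_degen_id j s : (j < size s)%N ->
  contract j (symb_degen_seq j s) = s.
Proof.
elim: j s => [|j IH] [|g s] //; first by rewrite /= gmul_idr.
rewrite ltnS => js; rewrite symb_degen_seqS ?contractS ?IH //.
exact: leq_trans js.
Qed.

(** The bound provides an entry after the inserted identity; composability makes this identity the
    one at its target, and the left unit law removes it. *)
Lemma contract_symb_degen_idS j s : (j.+1 < size s)%N ->
  sorted (@composable G) s -> contract j.+1 (symb_degen_seq j s) = s.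
Proof.
elim: j s => [|j IH] [|g s] //.
  by case: s => // h s _ /andP[/eqP gh _]; rewrite /= gh gmul_idl.
rewrite ltnS => js /path_sorted p.
by rewrite symb_degen_seqS ?contractS ?IH //; apply: leq_trans js.
Qed.

Lemma contract_symb_degen_gt i j s : (j.+1 < i < size s)%N ->
  contract i (symb_degen_seq j s) = symb_degen_seq j (contract i.-1 s).
Proof.
elim: j i s => [|j IH] [|[|i]] [|g s] // ; rewrite !ltnS => /andP[ij js].
  by rewrite [symb_degen_seq 0 (g :: s)]/= !contractS.
have s0 : (0 < size s)%N by apply: leq_trans js.
rewrite symb_degen_seqS // !contractS IH; last by rewrite ltnS ij.
have is1 : (i.+1 < size s)%N := js.
by rewrite symb_degen_seqS // size_contract //; case: (size s) is1 => [|[]].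
Qed.

(** The bound keeps the insertion before the last entry, the one moved to the front; hence the shift
    of the index by one. *)
Lemma symb_degen_seq_cyc j s : (j.+1 < size s)%N ->
  symb_degen_seq j.+1 (symb_cyc_seq s) = symb_cyc_seq (symb_degen_seq j s).
Proof.
case/lastP: s => // s k; rewrite size_rcons ltnS => js.
rewrite symb_degen_seq_rcons // !symb_cyc_seq_rcons symb_degen_seqS //.
exact: leq_trans js.
Qed.

Lemma symb_degen_seq_last s k : symb_degen_seq (size s) (rcons s k) =
  rcons (rcons s k) (idm (src k)).
Proof. by elim: s => //= g s <-; case: s. Qed.

Lemma contract_cyc i s : (i.+2 < size s)%N ->
  contract i.+1 (symb_cyc_seq s) = symb_cyc_seq (contract i s).
Proof.
case/lastP: s => // s k; rewrite size_rcons ltnS => js.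
by rewrite contract_rcons // !symb_cyc_seq_rcons contractS.
Qed.

Lemma contract_last s h k :
  contract (size s) (rcons (rcons s h) k) = rcons s (gmul h k).
Proof. by elim: s => //= g s <-; case: s. Qed.

Lemma symb_face_seq_cyc i s : (i.+1 < size s)%N ->
  symb_face_seq i.+1 (symb_cyc_seq s) = symb_cyc_seq (symb_face_seq i s).
Proof.
move=> si; rewrite [in RHS]symb_face_seqE //.
(* If the contracted pair consists of the last two entries h, k, rotation puts k in front and leaves
   h at the end, so on the rotated side h k is formed by the last face. *)
have [/eqP e|ne] := boolP (i.+2 == size s).
  have es : size (symb_cyc_seq s) = i.+2 by rewrite symb_cyc_seqE size_rotr e.
  rewrite -[i.+1]/(i.+2.-1) -es symb_face_seq_last ?es //.
  case/lastP: s e {si es} => // s k; rewrite size_rcons => -[e].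
  case/lastP: s e => // s h; rewrite size_rcons => -[->].
  by rewrite contract_last !symb_cyc_seq_rcons -rcons_cons symb_cyc_seq_rcons.
have si2 : (i.+2 < size s)%N by rewrite ltn_neqAle ne.
by rewrite symb_face_seqE ?contract_cyc // symb_cyc_seqE size_rotr.
Qed.

Lemma symb_face0_seq_cyc s : (1 < size s)%N ->
  symb_face_seq 0 (symb_cyc_seq s) = symb_face_seq (size s).-1 s.
Proof.
by move=> s1; rewrite symb_face_seq_last // symb_face_seqE // symb_cyc_seqE size_rotr.
Qed.

Lemma cycle_symb_cyc_seq s :
  cycle (@composable G) (symb_cyc_seq s) = cycle (@composable G) s.
Proof. by rewrite symb_cyc_seqE rotr_cycle. Qed.

Lemma cycle_sorted s : cycle (@composable G) s -> sorted (@composable G) s.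
Proof. by case: s => // g r; rewrite /= rcons_path => /andP[]. Qed.

Lemma size_symb_face_seq i s : (1 < size s)%N -> (i < size s)%N ->
  size (symb_face_seq i s) = (size s).-1.
Proof.
move=> s1 si; have [ls|ge] := ltnP i.+1 (size s).
  by rewrite symb_face_seqE // size_contract.
have es : size s = i.+1 by apply/eqP; rewrite eqn_leq ge.
have -> : i = (size s).-1 by rewrite es.
by rewrite symb_face_seq_last // size_contract symb_cyc_seqE size_rotr.
Qed.

(** When [j] is the last index, both sides are read on the rotated sequence [t]: the last face of
    [s] contracts [t] at 0, and the face [i] of [s] corresponds to the face [i.+1] of [t]. *)
Lemma symb_face_face_seq i j s : (i < j < size s)%N -> (2 < size s)%N ->
  cycle (@composable G) s ->
  symb_face_seq i (symb_face_seq j s) = symb_face_seq j.-1 (symb_face_seq i s).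
Proof.
move=> /andP[ij js] s2 cs; have s1 := ltnW s2; have so := cycle_sorted cs.
have [js1|sj] := ltnP j.+1 (size s).
  have is1 : (i.+1 < size s)%N by apply: leq_trans js1; rewrite ltnW ?ltnS.
  have [j0 si1] : (0 < j)%N /\ (1 < size s)%N.
    by split; [apply: leq_trans ij | apply: leq_trans is1].
  rewrite (symb_face_seqE js1) (symb_face_seqE is1).
  rewrite (symb_face_seqE (s := contract j s)); last first.
    by rewrite size_contract // -ltnS prednK ?(leq_trans _ js1) // ltnW.
  rewrite (symb_face_seqE (s := contract i s)); last first.
    by rewrite size_contract // prednK // -ltnS prednK // ltnW.
  exact: contract_contract.
have es : size s = j.+1 by apply/eqP; rewrite eqn_leq sj.
have ej : j = (size s).-1 by rewrite es.
set t := symb_cyc_seq s; have st : size t = size s by rewrite /t symb_cyc_seqE size_rotr.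
have ct : cycle (@composable G) t by rewrite cycle_symb_cyc_seq.
have so' := cycle_sorted ct.
have is1 : (i.+1 < size s)%N by apply: leq_trans js; rewrite ltnS.
rewrite [X in symb_face_seq i (symb_face_seq X s)]ej symb_face_seq_last // -/t.
rewrite (_ : j.-1 = (size (symb_face_seq i s)).-1); last first.
  by rewrite size_symb_face_seq ?ej // ltnW.
rewrite symb_face_seq_last ?size_symb_face_seq ?(ltnW is1) //; last first.
  by rewrite -ltnS prednK // ltnW.
rewrite -symb_face_seq_cyc // -/t.
have [is2|si2] := ltnP i.+2 (size s).
  rewrite !symb_face_seqE ?st ?size_contract ?st //; last first.
    by rewrite -ltnS prednK // ltnW // ltnW.
  by rewrite [RHS]contract_contract ?st.
(* Both sides now form g_(n-1) g_n g_0. A second rotation makes these the three leading entries, and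
   associativity concludes. *)
have ei : i.+1 = (size t).-1.
  by rewrite st (_ : size s = i.+2) //; apply/eqP; rewrite eqn_leq si2.
rewrite [in RHS]ei symb_face_seq_last ?st //.
set c := contract 0 t; have sc : size c = (size t).-1 by rewrite size_contract ?st.
rewrite (_ : i = (size c).-1); last by rewrite sc -ei.
rewrite symb_face_seq_last; last by rewrite sc st -ltnS prednK // ltnW.
rewrite /c -contract_cyc ?st // contract_contract //; last first.
  by apply: cycle_sorted; rewrite cycle_symb_cyc_seq.
by rewrite symb_cyc_seqE size_rotr st.
Qed.

Lemma symb_face_degen_seq_lt i j s : (i < j < size s)%N ->
  sorted (@composable G) s ->
  symb_face_seq i (symb_degen_seq j s) = symb_degen_seq j.-1 (symb_face_seq i s).
Proof.
move=> /andP[ij js] so; have s0 : (0 < size s)%N by apply: leq_trans js.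
have is1 : (i.+1 < size s)%N by apply: leq_trans js; rewrite ltnS.
rewrite !symb_face_seqE ?size_symb_degen_seq // ?contract_symb_degen_lt ?ij //.
by apply: ltnW.
Qed.

Lemma symb_face_degen_seq_id j s : (j < size s)%N ->
  symb_face_seq j (symb_degen_seq j s) = s.
Proof.
move=> js; have s0 : (0 < size s)%N by apply: leq_trans js.
by rewrite symb_face_seqE ?size_symb_degen_seq // contract_symb_degen_id.
Qed.

Lemma symb_face_degen_seq_idS j s : (j < size s)%N ->
  cycle (@composable G) s -> symb_face_seq j.+1 (symb_degen_seq j s) = s.
Proof.
move=> js cs; have s0 : (0 < size s)%N by apply: leq_trans js.
have [js1|sj] := ltnP j.+1 (size s).
  rewrite symb_face_seqE ?size_symb_degen_seq // contract_symb_degen_idS //.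
  exact: cycle_sorted.
(* The identity stands at the end and the last face multiplies it into g_0; the left unit law
   applies since s(g_n) = t(g_0) by cyclic composability. *)
have ej : j.+1 = size s by apply/eqP; rewrite eqn_leq js.
rewrite (_ : j.+1 = (size (symb_degen_seq j s)).-1); last first.
  by rewrite size_symb_degen_seq.
rewrite symb_face_seq_last ?size_symb_degen_seq //.
case/lastP: s cs ej {js s0 sj} => // s k; rewrite size_rcons => cs [->].
rewrite symb_degen_seq_last symb_cyc_seq_rcons.
rewrite -cycle_symb_cyc_seq symb_cyc_seq_rcons in cs.
case: s cs => [|g s] /= /andP[/eqP e _]; first by rewrite e gmul_idl.
by rewrite e gmul_idl.
Qed.

Lemma symb_face_degen_seq_gt i j s : (j.+1 < i <= size s)%N ->
  cycle (@composable G) s ->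
  symb_face_seq i (symb_degen_seq j s) = symb_degen_seq j (symb_face_seq i.-1 s).
Proof.
move=> /andP[ij js] cs.
have js1 : (j.+1 < size s)%N by apply: leq_trans js.
have s0 : (0 < size s)%N by apply: leq_trans js1.
have i0 : (0 < i)%N by apply: leq_trans ij.
have [js2|sj] := ltnP i (size s).
  rewrite !symb_face_seqE ?prednK ?size_symb_degen_seq //.
  by rewrite contract_symb_degen_gt ?ij.
(* Both faces are last faces. One rotation turns them into contractions at 0 and shifts the
   degeneracy to [j.+1], so the inserted identity lies beyond the contraction point. *)
have -> : i = size s by apply/eqP; rewrite eqn_leq js.
rewrite (_ : symb_face_seq (size s) _ = symb_face_seq (size (symb_degen_seq j s)).-1
  (symb_degen_seq j s)); last by rewrite size_symb_degen_seq.
rewrite !symb_face_seq_last ?size_symb_degen_seq ?(leq_trans _ js1) //.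
rewrite -symb_degen_seq_cyc // contract_symb_degen_lt //.
  by rewrite symb_cyc_seqE size_rotr.
by apply: cycle_sorted; rewrite cycle_symb_cyc_seq.
Qed.

(** Two rotations take the sequence s, k, Id to k, Id, s. *)
Lemma symb_degen0_seq_cyc s : (0 < size s)%N ->
  symb_degen_seq 0 (symb_cyc_seq s) =
  symb_cyc_seq (symb_cyc_seq (symb_degen_seq (size s).-1 s)).
Proof.
case/lastP: s => // s k _; rewrite size_rcons symb_degen_seq_last.
by rewrite !symb_cyc_seq_rcons -rcons_cons symb_cyc_seq_rcons.
Qed.

(** The prefix [r] collects the entries already moved, which makes the induction work; an empty [r]
    gives the identity for the power n+1 of [tau]. *)
Lemma iter_symb_cyc_seq_cat r s :
  iter (size s) (@symb_cyc_seq G) (r ++ s) = s ++ r.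
Proof.
elim/last_ind: s r => [|s k IH] r; first by rewrite cats0.
by rewrite size_rcons iterSr -rcons_cat symb_cyc_seq_rcons -cat_cons IH cat_rcons.
Qed.

End SequenceIdentities.

(** * Coefficients of vectors in tensor and cotensor products *)

Section FreeModules.
Context (K : fieldType).

Lemma freegU_scale (X : choiceType) (a : K) (x : X) :
  << a *g x >> = a *: << x >> :> {freeg X / K}.
Proof. by apply/eqP/freeg_eqP => y; rewrite coeffZ !coeffU mul1r. Qed.

Lemma linear_freeg_eq (X : choiceType) (M : lmodType K)
    (f g : {linear {freeg X / K} -> M}) :
  (forall x, f << x >> = g << x >>) -> f =1 g.
Proof.
move=> fg u; rewrite -(freeg_sumE u) !linear_sum; apply: eq_bigr => x _.
by rewrite freegU_scale !linearZ fg.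
Qed.

Lemma coeff_tens (X Y : choiceType) (u : {freeg X / K}) (v : {freeg Y / K}) x y :
  coeff (x, y) (tens u v) = coeff x u * coeff y v.
Proof.
(* [cf z] is the coefficient at [z] as a linear functional, so that identities between coefficients
   can be checked on basis vectors, first in [u] and then in [v]. *)
pose cf (Z : choiceType) (z : Z) := lin_ext (fun z' => (z' == z)%:R : K^o).
pose tl : {linear {freeg X / K} -> {freeg (X * Y)%type / K}} :=
  lin_ext (fun x => lin_ext (fun y => << (x, y) >>) v).
rewrite mulrC.
apply: (@linear_freeg_eq X K^o (cf _ (x, y) \o tl) (coeff y v \*: cf _ x)).
move=> x' /=; rewrite !liftU !scale1r.
transitivity ((x' == x)%:R * coeff y v); last by rewrite mulrC.
apply: (@linear_freeg_eq Y K^o (cf _ (x, y) \o lin_ext (fun y => << (x', y) >>))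
  ((x' == x)%:R \*: cf _ y)) => y' /=.
by rewrite !liftU !scale1r liftU scale1r xpair_eqE -mulnb natrM.
Qed.

(** Some summand v (x) w has a nonzero coefficient at [(x, y)], and this coefficient is a product.
    Information on the supports in each factor thus passes to the tensor product. *)
Lemma coeff_tens_space (X Y : choiceType) (V : {pred {freeg X / K}})
    (W : {pred {freeg Y / K}}) u x y :
  u \in tens_space V W -> coeff (x, y) u != 0 ->
  (exists2 v, v \in V & coeff x v != 0) /\ (exists2 w, w \in W & coeff y w != 0).
Proof.
move=> /asboolP[s /allP sP ->]; rewrite raddf_sum /=.
have [/hasP[[v w] /sP /= /andP[vV wW]]|/hasPn s0] :=
    boolP (has (fun p => coeff (x, y) (tens p.1 p.2) != 0) s).
  by rewrite coeff_tens mulf_eq0 negb_or => /andP[v0 w0] _; split; [exists v | exists w].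
by rewrite big1_seq ?eqxx // => p /andP[_ /s0]; rewrite negbK => /eqP.
Qed.

(** At [(x, (d x, y))] the left side of the cotensor equation has the coefficient of [u] at
    [(x, y)], the right side has the same multiplied by 1 or 0 according to whether [e y = d x]. *)
Lemma coeff_cotensor (X Y D : choiceType) (V : {pred {freeg X / K}})
    (rho : {linear {freeg X / K} -> {freeg (X * D)%type / K}})
    (W : {pred {freeg Y / K}})
    (lam : {linear {freeg Y / K} -> {freeg (D * Y)%type / K}})
    (d : X -> D) (e : Y -> D) u x y :
  (forall x, rho << x >> = << (x, d x) >>) ->
  (forall y, lam << y >> = << (e y, y) >>) ->
  u \in cotensor V rho W lam -> coeff (x, y) u != 0 -> d x = e y.
Proof.
move=> rhoE lamE /andP[_ /eqP eu].
pose cf (Z : choiceType) (z : Z) := lin_ext (fun z' => (z' == z)%:R : K^o).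
have El : coeff (x, (d x, y)) (tens_assoc K X D Y (tens_map rho idfun u)) =
          coeff (x, y) u.
  apply: (@linear_freeg_eq _ K^o
    (cf _ (x, (d x, y)) \o tens_assoc K X D Y \o tens_map rho idfun) (cf _ (x, y))).
  move=> [x' y'] /=; rewrite !liftU !scale1r /= rhoE tensUU !liftU !scale1r liftU scale1r.
  congr (_%:R); congr nat_of_bool; rewrite !xpair_eqE; case: (x' =P x) => //= ->.
  by rewrite eqxx.
have Er : coeff (x, (d x, y)) (tens_map idfun lam u) =
          (e y == d x)%:R * coeff (x, y) u.
  apply: (@linear_freeg_eq _ K^o
    (cf _ (x, (d x, y)) \o tens_map idfun lam) ((e y == d x)%:R \*: cf _ (x, y))).
  move=> [x' y'] /=; rewrite !liftU !scale1r /= lamE tensUU !liftU !scale1r.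
  rewrite [RHS]/GRing.scale /= -natrM mulnb; congr (_%:R); congr nat_of_bool.
  rewrite !xpair_eqE; case: (y' =P y) => [->|_].
    by rewrite !andbT andbC.
  by rewrite !andbF.
by rewrite -El eu Er; case: (e y =P d x) => [->//|_]; rewrite mul0r eqxx.
Qed.

End FreeModules.

(** * The symbols form a basis of the cotensor product *)

Section Basis.
Context (G : groupoid) (th : cyclic_structure G) (K : fieldType).

(** Induction on the number of factors: the tail lies in the support of a vector of the smaller
    power, and the cotensor condition over C joins the first entry to it. *)
Lemma coeff_Bpow n u (t : n.+1.-tuple (mor G)) :
  u \in @Bpow G K n -> coeff t u != 0 ->
  path (@composable G) (thead t) (behead t).
Proof.
elim: n u t => [|n IH] u t; first by case/tupleP: t => g r; rewrite (tuple0 r).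
pose cf (Z : choiceType) (z : Z) := lin_ext (fun z' => (z' == z)%:R : K^o).
case/tupleP: t => g t; rewrite theadE /=.
rewrite [_ \in _]/(_ \in _) /in_mem /=; set v := fglift _ u => uP u0.
have v0 : coeff (g, t) v != 0.
  (* Splitting off the first factor is injective on basis vectors, so no coefficients merge. *)
  suff -> : coeff (g, t) v = coeff [tuple of g :: t] u by [].
  apply: (@linear_freeg_eq _ _ K^o
    (cf _ (g, t) \o Bpow_split G K n) (cf _ [tuple of g :: t])) => t' /=.
  rewrite !liftU !scale1r liftU scale1r; congr (_%:R); congr nat_of_bool.
  by case/tupleP: t' => g' t'; rewrite theadE xpair_eqE -!val_eqE /= eqseq_cons.
have [/andP[ts _]] := conj uP v0.
have [_ [w wP w0]] := coeff_tens_space ts v0.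
have := IH _ _ wP w0.
have rhoE h : B_rcoact G K << h >> = << (h, src h) >> by rewrite /= liftU scale1r.
have lamE (r : n.+1.-tuple (mor G)) : Bpow_lcoact G K n << r >> = << (tgt (thead r), r) >>.
  by rewrite /= liftU scale1r.
have := coeff_cotensor rhoE lamE uP v0.
by case/tupleP: t {ts v0 u0 w0} => h r; rewrite theadE /= /composable => -> ->; rewrite eqxx.
Qed.

(** The cotensor condition over B equates g_0 ... g_n with theta_c; the closing condition s(g_n) =
    t(g_0) follows because theta_c is an endomorphism. *)
Lemma coeff_CB_pred n u p :
  u \in @CB_pred G th K n -> coeff p u != 0 -> symb_ok th p.1 p.2.
Proof.
case: p => t c uP u0; have [/andP[ts _]] := conj uP u0.
have [[v vP v0] _] := coeff_tens_space ts u0.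
have tp := coeff_Bpow vP v0.
have rhoE (r : n.+1.-tuple (mor G)) :
    Bpow_rcoact G K n << r >> = << (r, gprod (thead r) (behead r)) >>.
  by rewrite /= liftU scale1r.
have lamE b : C_lcoact th K << b >> = << (th b, b) >> by rewrite /= liftU scale1r.
have := coeff_cotensor rhoE lamE uP u0.
case/tupleP: t tp {ts u0 v0} => g r; rewrite theadE /= => gr e.
by rewrite -/(symb_ok th (g :: r) c) symb_okE gr e eqxx.
Qed.

Lemma val_CB_sum n (I : Type) (s : seq I) (a : I -> K) (x : I -> symb th n) :
  val (\sum_(i <- s) a i *: symb_vec K (x i)) =
  \sum_(i <- s) << a i *g sval (x i) >>.
Proof.
elim: s => [|i s IH]; first by rewrite !big_nil.
by rewrite !big_cons -IH freegU_scale.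
Qed.

Lemma CB_sum n (u : CB th K n) :
  u = \sum_(x <- pmap insub (dom (val u))) coeff (sval x) (val u) *: symb_vec K x.
Proof.
apply: val_inj; rewrite val_CB_sum big_pmap /= -[LHS]freeg_sumE.
rewrite big_seq [RHS]big_seq; apply: eq_bigr => p; rewrite mem_dom => p0.
(* Every point of the support is a symbol, so [insub] discards nothing. *)
by have pP := coeff_CB_pred (valP u) p0; rewrite insubT.
Qed.

Lemma symb_vec_basis n : is_basis (@symb_vec G th K n).
Proof.
split=> [s a us sum0 x xs|u]; last first.
  by exists (pmap insub (dom (val u))), (fun x => coeff (sval x) (val u)); exact: CB_sum.
(* The functional dual to [x] is applied to the vanishing sum. *)
have := congr1 (symb_ext (fun y => (y == x)%:R : K^o)) sum0.
rewrite linear_sum linear0 (bigD1_seq x) //= linearZ /= symb_extE eqxx.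
rewrite big1 ?addr0 => [|y yx]; first by rewrite /GRing.scale /= mulr1.
by rewrite linearZ /= symb_extE (negPf yx) scaler0.
Qed.

(** Linearity is a hypothesis on plain functions, so that composites of structure maps can be
    compared directly. *)
Lemma linear_symb_eq n (M : lmodType K) (f g : CB th K n -> M) :
  linear f -> linear g ->
  (forall x, f (symb_vec K x) = g (symb_vec K x)) -> f =1 g.
Proof.
move=> fl gl fg u.
pose fL : {linear CB th K n -> M} := HB.pack f (GRing.isLinear.Build K _ _ _ f fl).
pose gL : {linear CB th K n -> M} := HB.pack g (GRing.isLinear.Build K _ _ _ g gl).
rewrite -[f]/(fL : _ -> _) -[g]/(gL : _ -> _) (CB_sum u) !linear_sum.
by apply: eq_bigr => x _; rewrite !linearZ /= fg.
Qed.

End Basis.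

(** * The bijection between symbols and the nerve *)

Section Symbols.
Context (G : groupoid) (th : cyclic_structure G).
Implicit Types (n i j : nat).

Lemma symb_size n (x : symb th n) : size (sval x).1 = n.+1.
Proof. exact: size_tuple. Qed.

(** The product of the entries is theta_c, whose source is [c], and a product has the source of its
    last entry. *)
Lemma symb_ok_ob g r c : symb_ok th (g :: r) c -> c = src (last g r).
Proof.
rewrite symb_okE => /andP[gr /eqP e].
by rewrite -(src_theta th c) -e src_gprod.
Qed.

Lemma symb_cycle n (x : symb th n) : cycle (@composable G) (sval x).1.
Proof.
by case: x => -[t c] ok; case/tupleP: t ok => g r; rewrite /sval /symb_ok => /andP[].
Qed.

(** In the cyclic identities only sequences have to be compared, since they determine the objects
    obtained from the action on C. *)
Lemma symb_seq_inj n (x y : symb th n) :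
  (sval x).1 = (sval y).1 :> seq (mor G) -> x = y.
Proof.
case: x y => -[t c] tc [[u d] ud] /= /val_inj tu; apply: val_inj => /=.
subst u; congr (_, _); case/tupleP: t tc ud => g r gc gd.
by have /= -> := symb_ok_ob gc; have /= -> := symb_ok_ob gd.
Qed.

Lemma nerve_seq_inj n (s t : nerve G n.+1) :
  sval s = sval t :> seq (mor G) -> s = t.
Proof. by move=> /val_inj e; apply: val_inj. Qed.

Lemma gprod_cons (g h : mor G) r : path (@composable G) g (h :: r) ->
  gprod g (h :: r) = gprod (gmul g h) r.
Proof.
case: r => //= k r /and3P[/eqP gh /eqP hk kr].
by rewrite gmulA // tgt_gprod.
Qed.

(** The inverses cancel from the inside out. For theta_c = g_0 ... g_n this recovers g_0 from the
    first entry of [tau] on the nerve. *)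
Lemma gprod_mulV (g : mor G) s : path (@composable G) g s ->
  gprod (gprod g s) (rev (map (@ginv G) s)) = g.
Proof.
elim/last_ind: s => // s k IH gsk.
have P : path (@composable G) (gprod g (rcons s k)) (rev (map (@ginv G) (rcons s k))).
  case: s gsk {IH} => [/andP[/eqP p _]|h s p].
    by rewrite /= /composable src_gmul // tgt_ginv eqxx.
  rewrite rcons_cons; apply: path_rev_ginv; first by case/andP: p.
  by rewrite src_gprod.
rewrite map_rcons rev_rcons gprod_cons -?rev_rcons -?map_rcons //.
rewrite gprod_rcons //; move: gsk; rewrite rcons_path => /andP[gs /eqP sk].
rewrite -gmulA ?src_gprod ?tgt_ginv // gmulgV -sk -src_gprod // gmul_idr.
exact: IH.
Qed.

Lemma gmul_invr (g h : mor G) : src g = tgt h -> gmul (gmul g h) (ginv h) = g.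
Proof. by move=> gh; rewrite -gmulA ?tgt_ginv // gmulgV -gh gmul_idr. Qed.

(** The outer faces of a symbol merge g_1 or the last entry into g_0; forgetting g_0 turns this into
    a deletion at an end of the nerve sequence. *)
Lemma symb_nerve_face n i (x : symb th n.+1) : (i <= n.+1)%N ->
  symb_nerve (symb_face i x) = nerve_face i (symb_nerve x).
Proof.
case: n x => [|n] x i1.
  case: x => -[t c] ok; case/tupleP: t ok => g t; case/tupleP: t => h t ok.
  (* In the nerve the target is the set of objects: face 0 keeps [c], which is s(g_1), and face 1
     gives the source of the inverse of g_1, which is t(g_1). *)
  have := symb_ok_ob ok; rewrite /= /thead (tnth_nth h) /= (tuple0 t) /= => e.
  by case: i i1 => [|[|]] //= _; rewrite /C_ract src_ginv.
apply: nerve_seq_inj; case: x => -[t c] ok; case/tupleP: t ok => g t.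
case/tupleP: t => h t ok /=.
by case: i i1 => [|i] //= _; rewrite ltnS; case: ltnP => //; case: (tval t); case: i.
Qed.

(** At [j = 0] the symbol receives the identity at s(g_0) and the nerve the one at t(g_1), or at [c]
    when [n = 0]; these objects agree. *)
Lemma symb_nerve_degen n j (x : symb th n) : (j <= n)%N ->
  symb_nerve (symb_degen j x) = nerve_degen j (symb_nerve x).
Proof.
case: n x => [|n] [[t c] ok] j0; apply: nerve_seq_inj.
  case/tupleP: t ok => g t ok; have := symb_ok_ob ok.
  by rewrite /= (tuple0 t) /= => ->; case: j j0.
case/tupleP: t ok => g t; case/tupleP: t => h t ok.
have := ok; rewrite symb_okE => /andP[/andP[/eqP gh _] _] /=.
by case: j {j0} => //=; rewrite gh.
Qed.

Lemma symb_nerve_cyc n (x : symb th n) :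
  symb_nerve (symb_cyc x) = nerve_cyc th (symb_nerve x).
Proof.
case: n x => [|n] [[t c] ok] /=.
  case/tupleP: t ok => g t ok; have := ok; rewrite symb_okE /= (tuple0 t) /=.
  by move=> /eqP ->; rewrite /C_ract src_ginv tgt_theta.
apply: nerve_seq_inj; case/tupleP: t ok => g t; case/tupleP: t => h t ok /=.
congr (_ :: _); have := symb_ok_ob ok; rewrite symb_okE in ok.
by case/andP: ok => p /eqP e /= <-; rewrite -e gprod_mulV.
Qed.

Lemma symb_nerveK n : cancel (@symb_nerve G th n) (@nerve_symb G th n).
Proof.
case: n => [|n] [[t c] ok]; apply: symb_seq_inj.
  case/tupleP: t ok => g t ok; have := ok; rewrite symb_okE /= (tuple0 t) /=.
  by move=> /eqP ->.
case/tupleP: t ok => g t; case/tupleP: t => h t ok /=.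
(* Only the first entry has to be recovered: g_0 is theta_c times the inverse of g_1 ... g_n. *)
congr (_ :: _); have := symb_ok_ob ok; rewrite symb_okE in ok.
case/andP: ok => p /eqP e /= <-; rewrite -e /= gmul_invr //.
by case/andP: p => /eqP gh ht; rewrite tgt_gprod.
Qed.

Lemma nerve_symbK n : cancel (@nerve_symb G th n) (@symb_nerve G th n).
Proof.
case: n => [|n] // [t tP]; apply: nerve_seq_inj => /=.
by case/tupleP: t tP.
Qed.

(** * Cyclic identities on the cotensor side and the linear isomorphism *)

Context (K : fieldType).

Let faceE n i x : face (CB_ops th K) n i (symb_vec K x) = symb_vec K (symb_face i x).
Proof. exact: symb_extE. Qed.
Let degenE n i x : degen (CB_ops th K) n i (symb_vec K x) = symb_vec K (symb_degen i x).
Proof. exact: symb_extE. Qed.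
Let cycE n x : cyc (CB_ops th K) n (symb_vec K x) = symb_vec K (symb_cyc x).
Proof. exact: symb_extE. Qed.

Lemma iter_linear (V : lmodType K) (f : {linear V -> V}) m : linear (iter m f).
Proof. by elim: m => [|m IH] a u v //=; rewrite IH linearP. Qed.

Lemma CB_ops_cyclic : is_cyclic_module (CB_ops th K).
Proof.
(* Composites of two, three and one linear maps are linear, which reduces each identity below to
   symbols. *)
have lin2 (U V W : lmodType K) (f : {linear U -> V}) (g : {linear V -> W}) :
  linear (fun x => g (f x)) by move=> a u v; rewrite !linearP.
have lin3 (U V W X : lmodType K) (f : {linear U -> V}) (g : {linear V -> W})
    (h : {linear W -> X}) :
  linear (fun x => h (g (f x))) by move=> a u v; rewrite !linearP.
have lin1 (U V : lmodType K) (f : {linear U -> V}) : linear (fun x => f x).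
  by move=> a u v; rewrite linearP.
split; [split; [| |split]|split].
- move=> n i j x ij; move: x.
  apply: linear_symb_eq => // x; rewrite !faceE; congr symb_vec; apply: symb_seq_inj.
  by apply: symb_face_face_seq; rewrite ?symb_size //; apply: symb_cycle.
- move=> n i j x ij; move: x.
  apply: linear_symb_eq => // x; rewrite !degenE; congr symb_vec; apply: symb_seq_inj.
  by apply: symb_degen_degen_seq; rewrite ?symb_size.
- move=> n i j x ij; move: x.
  apply: linear_symb_eq => // x; rewrite degenE !faceE degenE.
  congr symb_vec; apply: symb_seq_inj.
  apply: symb_face_degen_seq_lt; rewrite ?symb_size //.
  exact: cycle_sorted (symb_cycle x).
- move=> n j x ij; move: x.
  apply: linear_symb_eq => // x; rewrite degenE !faceE.
  congr symb_vec; apply: symb_seq_inj.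
  by apply: symb_face_degen_seq_id; rewrite ?symb_size.
- move=> n j x ij; move: x.
  apply: linear_symb_eq => // x; rewrite degenE !faceE.
  congr symb_vec; apply: symb_seq_inj.
  by apply: symb_face_degen_seq_idS; rewrite ?symb_size //; apply: symb_cycle.
- move=> n i j x ij; move: x.
  apply: linear_symb_eq => // x; rewrite degenE !faceE degenE.
  congr symb_vec; apply: symb_seq_inj.
  by apply: symb_face_degen_seq_gt; rewrite ?symb_size //; apply: symb_cycle.
- move=> n [|i] x // ij; move: x.
  apply: linear_symb_eq => // x; rewrite cycE !faceE cycE.
  congr symb_vec; apply: symb_seq_inj.
  by apply: symb_face_seq_cyc; rewrite symb_size.
- move=> n; apply: linear_symb_eq => // x; rewrite cycE !faceE.
  congr symb_vec; apply: symb_seq_inj.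
  have := @symb_face0_seq_cyc G (sval x).1; rewrite symb_size; exact.
- move=> n [|i] x // ij; move: x.
  apply: linear_symb_eq => // x; rewrite cycE !degenE cycE.
  congr symb_vec; apply: symb_seq_inj.
  by apply: symb_degen_seq_cyc; rewrite symb_size.
- move=> n; apply: linear_symb_eq => // x; rewrite cycE !degenE !cycE.
  congr symb_vec; apply: symb_seq_inj.
  have := @symb_degen0_seq_cyc G (sval x).1; rewrite symb_size; exact.
- move=> n; apply: linear_symb_eq => //; first exact: iter_linear.
  move=> x.
  (* The iterates of [tau] keep symbols among symbols, so the computation descends to sequences. *)
  have -> m : iter m (cyc (CB_ops th K) n) (symb_vec K x) = 
      symb_vec K (iter m (@symb_cyc _ _ n) x).
    by elim: m => //= m ->; rewrite cycE.
  congr symb_vec; apply: symb_seq_inj.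
  have -> m : (sval (iter m (@symb_cyc _ _ n) x)).1 =
      iter m (@symb_cyc_seq G) (sval x).1 :> seq (mor G).
    by elim: m => //= m <-.
  by have := iter_symb_cyc_seq_cat [::] (sval x).1; rewrite symb_size cats0; apply.
Qed.

Lemma CB_to_CG_vec n (x : symb th n) : CB_to_CG th K n (symb_vec K x) = << symb_nerve x >>.
Proof. exact: symb_extE. Qed.

Lemma CG_to_CB_U n (t : nerve G n) :
  CG_to_CB th K n << t >> = symb_vec K (nerve_symb th t).
Proof. by rewrite /= liftU scale1r. Qed.

Lemma CB_to_CG_morphism :
  is_cyclic_morphism (CB_ops th K) (CG_ops th K) (@CB_to_CG G th K).
Proof.
have lin2 (U V W : lmodType K) (f : {linear U -> V}) (g : {linear V -> W}) :
  linear (fun x => g (f x)) by move=> a u v; rewrite !linearP.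
split.
- move=> n i x i1; move: x; apply: linear_symb_eq => // x.
  by rewrite faceE !CB_to_CG_vec symb_nerve_face //= liftU scale1r.
- move=> n i x i1; move: x; apply: linear_symb_eq => // x.
  by rewrite degenE !CB_to_CG_vec symb_nerve_degen //= liftU scale1r.
- move=> n; apply: linear_symb_eq => // x.
  by rewrite cycE !CB_to_CG_vec symb_nerve_cyc //= liftU scale1r.
Qed.

Lemma CB_to_CGK n : cancel (CB_to_CG th K n) (CG_to_CB th K n).
Proof.
apply: linear_symb_eq => [a u v|//|x]; first by rewrite !linearP.
by rewrite CB_to_CG_vec CG_to_CB_U symb_nerveK.
Qed.

Lemma CG_to_CBK n : cancel (CG_to_CB th K n) (CB_to_CG th K n).
Proof.
apply: (linear_freeg_eq (f := CB_to_CG th K n \o CG_to_CB th K n) (g := idfun)).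
by move=> t; rewrite [LHS]/= CG_to_CB_U CB_to_CG_vec nerve_symbK.
Qed.
End Symbols.

(** * Transport of the cyclic identities and conclusion *)

(** Each vector of the target is [f] of its image under [g]; moving [f] outward through the
    operations reduces an identity of [B] to the same one in [A]. *)
Lemma is_cyclic_module_transport (K : fieldType) (V W : nat -> lmodType K)
    (A : cyclic_ops V) (B : cyclic_ops W)
    (f : forall n, {linear V n -> W n}) (g : forall n, W n -> V n) :
  is_cyclic_module A -> is_cyclic_morphism A B f ->
  (forall n, cancel (g n) (f n)) -> is_cyclic_module B.
Proof.
move=> [[ff dd [fd fid fidS fdg]] [ft f0 dt d0 tt]] [fF fD fC] gK.
have fCm n m x : f n (iter m (cyc A n) x) = iter m (cyc B n) (f n x).
  by elim: m => //= m <-; rewrite fC.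
split; [split; [| |split]|split].
- move=> n i j x ij; rewrite -(gK _ x).
  (* [f] commutes with faces only within the range of valid indices, so the bounds for all four
     faces are collected first. *)
  have /and4P[i1 i2 j1 j2] : [&& i <= n.+1, i <= n.+2, j <= n.+2 & j.-1 <= n.+1]%N.
    by clear -ij; lia.
  by rewrite -(fF _ _ _ j1) -(fF _ _ _ i1) (ff _ _ _ _ ij) (fF _ _ _ j2) (fF _ _ _ i2).
- move=> n i j x ij; rewrite -(gK _ x).
  have /and3P[i1 i2 j1] : [&& i <= n.+1, i <= n & j <= n]%N by clear -ij; lia.
  by rewrite -(fD _ _ _ j1) -(fD _ _ _ i1) (dd _ _ _ _ ij) fD // (fD _ _ _ i2).
- move=> n i j x ij; rewrite -(gK _ x).
  have /and4P[i1 i2 j1 j2] : [&& i <= n.+2, i <= n.+1, j <= n.+1 & j.-1 <= n]%N.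
    by clear -ij; lia.
  by rewrite -(fD _ _ _ j1) -(fF _ _ _ i1) (fd _ _ _ _ ij) (fD _ _ _ j2) (fF _ _ _ i2).
- move=> n j x jn; rewrite -(gK _ x) -(fD _ _ _ jn) -(fF _ _ _ (leqW jn)).
  by rewrite (fid _ _ _ jn).
- move=> n j x jn; rewrite -(gK _ x) -(fD _ _ _ jn).
  have j1 : (j.+1 <= n.+1)%N by [].
  by rewrite -(fF _ _ _ j1) (fidS _ _ _ jn).
- move=> n i j x ij; rewrite -(gK _ x).
  have /and4P[i1 i2 j1 j2] : [&& i <= n.+2, i.-1 <= n.+1, j <= n.+1 & j <= n]%N.
    by clear -ij; lia.
  by rewrite -(fD _ _ _ j1) -(fF _ _ _ i1) (fdg _ _ _ _ ij) (fD _ _ _ j2) (fF _ _ _ i2).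
- move=> n i x i0; rewrite -(gK _ x).
  have /andP[i1 i2] : [&& i <= n.+1 & i.-1 <= n.+1]%N by clear -i0; lia.
  by rewrite -fC -(fF _ _ _ i1) (ft _ _ _ i0) fC (fF _ _ _ i2).
- move=> n x; rewrite -(gK _ x).
  by rewrite -fC -(fF _ _ _ (leq0n _)) f0 (fF _ _ _ (leqnn _)).
- move=> n i x i0; rewrite -(gK _ x).
  have /andP[i1 i2] : [&& i <= n & i.-1 <= n]%N by clear -i0; lia.
  by rewrite -fC -(fD _ _ _ i1) (dt _ _ _ i0) fC (fD _ _ _ i2).
- move=> n x; rewrite -(gK _ x).
  by rewrite -fC -(fD _ _ _ (leq0n _)) d0 !fC (fD _ _ _ (leqnn _)).
- by move=> n x; rewrite -(gK _ x) -fCm tt.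
Qed.

Theorem mainTheorem1 (R : realType) (G : groupoid) (th : cyclic_structure G) :
  (forall n : nat, is_basis (@symb_vec G th R[i]%C n)) /\
  is_cyclic_module (CB_ops th R[i]%C) /\
  is_cyclic_iso (CB_ops th R[i]%C) (CG_ops th R[i]%C)
    (@CB_to_CG G th R[i]%C) (@CG_to_CB G th R[i]%C).
Proof.
split; first by move=> n; exact: symb_vec_basis.
split; first exact: CB_ops_cyclic.
split.
- exact: CB_ops_cyclic.
- apply: is_cyclic_module_transport (CB_to_CG_morphism th _) (@CG_to_CBK G th _).
  exact: CB_ops_cyclic.
- exact: CB_to_CG_morphism.
- by move=> n; split; [exact: CB_to_CGK | exact: CG_to_CBK].
Qed.
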